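(* Let $1\le k\le n$ and $w\in\mathcal{W}_{n,k}$. Then the PR variety $\overline{C}_w$ equals the set of spanning line configurations in $X_{n,k}$ represented by matrices all of whose flag minors indexed by $T_w$ vanish: \[\overline{C}_w=\{A\in X_{n,k} : \Delta_J(A)=0 \text{ for all } J\in T_w\}.\]
   Context: A Fubini word $w=w_1\cdots w_n\in\mathcal{W}_{n,k}$ is a surjection $w:[n]\to[k]$, written $w_j=w(j)$. Let $\mathcal{F}_{k\times n}(\mathbb{C})$ be the set of complex $k\times n$ matrices of rank $k$ with no zero column; the group $T$ of invertible diagonal $n\times n$ matrices acts on it on the right, and $X_{n,k}=\mathcal{F}_{k\times n}(\mathbb{C})/T$, identified with the set of $n$-tuples of lines $(l_1,\dots,l_n)\in(\mathbb{P}^{k-1})^n$ with $l_1+\cdots+l_n=\mathbb{C}^k$ (an open subvariety of $(\mathbb{P}^{k-1})^n$). For $w\in\mathcal{W}_{n,k}$, $M_w$ is the $k\times n$ matrix with a $1$ in position $(w_j,j)$ for each $j$ and $0$ elsewhere. For $i\in[k]$, $\alpha_i(w)$ is the position of the first occurrence of the letter $i$ in $w$, and $\mathrm{in}(w)=\{\alpha_1(w),\dots,\alpha_k(w)\}$ is the set of initial positions. The pattern matrix $P_w$ is obtained from $M_w$ by replacing the $0$ in position $(w_i,j)$ by a $\star$ whenever $i\in\mathrm{in}(w)$, $i<\alpha_{w_j}(w)$, and either ($j\in\mathrm{in}(w)$ and $w_i<w_j$) or $j\notin\mathrm{in}(w)$; $P_w$ also denotes the set of complex matrices obtained by substituting arbitrary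 complex numbers for the $\star$'s. Let $U$ be the group of $k\times k$ lower unitriangular complex matrices. The PR cell $C_w$ is (the image in $X_{n,k}$ of) $UP_w=\{XY : X\in U, Y\in P_w\}$, and the PR variety $\overline{C}_w$ is its Zariski closure in $X_{n,k}$. (It is known that every $M\in\mathcal{F}_{k\times n}(\mathbb{C})$ can be written uniquely as $XYZ$ with $X\in U$, $Y\in P_w$ for a unique $w$, $Z\in T$.) Let $\binom{[n]}{[k]}$ denote the set of subsets of $[n]$ of size between $1$ and $k$. For $J\in\binom{[n]}{[k]}$, the flag minor $\Delta_J(A)$ is the determinant of the submatrix of $A$ in rows $1,\dots,|J|$ and columns $J$; whether it vanishes is well defined on points of $X_{n,k}$. Define $T_w=\{J\in\binom{[n]}{[k]} : \Delta_J(M)=0 \text{ for all } M\in C_w\}$. *)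

(* Defs.v *)
From HB Require Import structures.
From mathcomp Require Import all_boot all_algebra.
From mathcomp Require Import boolp classical_sets reals.
From mathcomp Require Import complex mpoly.

Set Implicit Arguments.
Unset Strict Implicit.
Unset Printing Implicit Defensive.

Import GRing.Theory.

Local Open Scope ring_scope.
Local Open Scope classical_set_scope.
Local Open Scope quotient_scope.

(* Letters, rows, positions and columns are numbered from 0 ('I_k and 'I_n);
   every condition below only compares them with one another. *)

Section FubiniWords.
Variables n k : nat.
Implicit Type w : n.-tuple 'I_k.

Definition fubini w : bool := [forall i, i \in w].

(* index i w is the position of the first occurrence of i in w. *)
Definition alpha w (i : 'I_k) : nat := index i w.

Definition initial w (j : 'I_n) : bool := [exists i, alpha w i == j :> nat].

Definition star w (r : 'I_k) (j : 'I_n) : bool :=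
  (r != tnth w j) &&
  [exists i : 'I_n,
    [&& tnth w i == r, initial w i, (i < alpha w (tnth w j))%N &
        (initial w j && (tnth w i < tnth w j)%N) || ~~ initial w j]].

End FubiniWords.

Section LineConfigurations.
Variables (F : fieldType) (k n : nat).

Definition frame : Type :=
  {A : 'M[F]_(k, n) | (\rank A == k) && [forall j, col j A != 0]}.
HB.instance Definition _ := Choice.on frame.

Definition torus_eqb : rel frame := fun A B =>
  `[< exists Z : 'M[F]_n,
      [/\ is_diag_mx Z, Z \in unitmx & val B = val A *m Z] >].

Lemma torus_eqP (A B : frame) :
  reflect (exists2 z : 'I_n -> F, forall j, z j != 0 &
             forall i j, val B i j = val A i j * z j)
          (torus_eqb A B).
Proof.
apply: (iffP (asboolP _)) => [[Z [/is_diag_mxP Zd Zu eB]]|[z z0 eB]].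
  have eZ : Z = diag_mx (\row_j Z j j).
    apply/matrixP => i j; rewrite !mxE; case: eqVneq => [->|ij].
      by rewrite mulr1n.
    by rewrite mulr0n Zd.
  exists (fun j => Z j j) => [j|i j].
    move: Zu; rewrite unitmxE eZ det_diag unitfE => /prodf_neq0 /(_ j isT).
    by rewrite !mxE eqxx mulr1n.
  by rewrite eB eZ mul_mx_diag !mxE eqxx mulr1n.
exists (diag_mx (\row_j z j)); split.
- exact: diag_mx_is_diag.
- rewrite unitmxE det_diag unitfE; apply/prodf_neq0 => j _.
  by rewrite mxE.
- by apply/matrixP => i j; rewrite mul_mx_diag !mxE eB.
Qed.

Lemma torus_eqb_refl : reflexive torus_eqb.
Proof.
move=> A; apply/torus_eqP; exists (fun=> 1) => [j|i j]; first exact: oner_neq0.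
by rewrite mulr1.
Qed.

Lemma torus_eqb_sym : ssrbool.symmetric torus_eqb.
Proof.
suff imp A B : torus_eqb A B -> torus_eqb B A.
  by move=> A B; apply/idP/idP; apply: imp.
case/torus_eqP => z z0 e; apply/torus_eqP.
exists (fun j => (z j)^-1) => [j|i j]; first by rewrite invr_eq0.
by rewrite e mulfK.
Qed.

Lemma torus_eqb_trans : transitive torus_eqb.
Proof.
move=> B A C /torus_eqP[z z0 e] /torus_eqP[z' z0' e']; apply/torus_eqP.
exists (fun j => z j * z' j) => [j|i j]; first by rewrite mulf_neq0.
by rewrite e' e mulrA.
Qed.

Canonical torus_equiv :=
  EquivRel torus_eqb torus_eqb_refl torus_eqb_sym torus_eqb_trans.

Definition line_config : Type := {eq_quot torus_equiv}.
HB.instance Definition _ := Choice.on line_config.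
HB.instance Definition _ := EqQuotient.on line_config.

(* Polynomials in the entries of a k x n matrix; the variable attached to
   entry (i, j) is the one of index mxvec_index i j. *)
Definition eval_mx (p : {mpoly F[k * n]}) (A : 'M[F]_(k, n)) : F :=
  p.@[fun v => mxvec A 0 v].

(* d j is the degree in the entries of column j, i.e. in the homogeneous
   coordinates of the j-th factor of (P^(k-1))^n. *)
Definition multihomog (d : 'I_n -> nat) (p : {mpoly F[k * n]}) : Prop :=
  forall m, m \in msupp p ->
    forall j : 'I_n, (\sum_(i < k) m (mxvec_index i j))%N = d j.

(* Vanishing is tested on the representative repr x; see multihomog_vanish
   and minor_vanish for the independence of that choice. *)
Definition vanish_at (p : {mpoly F[k * n]}) (x : line_config) : Prop :=
  eval_mx p (val (repr x)) = 0.

(* Closed sets of the topology induced by (P^(k-1))^n. *)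
Definition zariski_closed (Z : set line_config) : Prop :=
  exists2 S : set {mpoly F[k * n]},
    (forall p, S p -> exists d, multihomog d p) &
    Z = [set x | forall p, S p -> vanish_at p x].

Definition zariski_closure (Y : set line_config) : set line_config :=
  smallest zariski_closed Y.

Definition flag_index : Type := {J : {set 'I_n} | (0 < #|J| <= k)%N}.

Lemma flag_index_le (J : flag_index) : (#|val J| <= k)%N.
Proof. by case/andP: (valP J). Qed.

(* enum_val lists the columns of J in increasing order. *)
Definition flag_minor (J : flag_index) (A : 'M[F]_(k, n)) : F :=
  \det (mxsub (widen_ord (flag_index_le J)) (@enum_val _ (mem (val J))) A).

Definition minor_vanish_at (J : flag_index) (x : line_config) : Prop :=
  flag_minor J (val (repr x)) = 0.

Lemma repr_torus (A : frame) :
  exists2 z : 'I_n -> F, forall j, z j != 0 &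
    forall i j, val (repr (\pi_line_config A)) i j = val A i j * z j.
Proof.
by apply/torus_eqP; apply/eqmodP; rewrite reprK.
Qed.

Lemma multihomog_vanish d p (A : frame) : multihomog d p ->
  vanish_at p (\pi_line_config A) <-> eval_mx p (val A) = 0.
Proof.
move=> hp; have [z z0 e] := repr_torus A; rewrite /vanish_at.
suff -> : eval_mx p (val (repr (\pi_line_config A))) =
          (\prod_j z j ^+ d j) * eval_mx p (val A).
  split=> [/eqP|->]; last by rewrite mulr0.
  rewrite mulf_eq0 => /orP[|/eqP //] /eqP h.
  suff: \prod_j z j ^+ d j != 0 by rewrite h eqxx.
  by apply/prodf_neq0 => j _; rewrite expf_neq0.
rewrite /eval_mx !mevalE mulr_sumr; apply: eq_big_seq => m mp.
rewrite mulrCA; congr (_ * _).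
have re (f : 'I_(k * n) -> F) :
    \prod_v f v = \prod_(j < n) \prod_(i < k) f (mxvec_index i j).
  rewrite (reindex _ (curry_mxvec_bij k n)) /= exchange_big /=.
  by rewrite pair_bigA /=; apply: eq_bigr => -[].
rewrite !re -big_split /=; apply: eq_bigr => j _.
rewrite -(hp m mp j) -prodrXr -big_split /=; apply: eq_bigr => i _.
by rewrite !mxvecE e exprMn mulrC.
Qed.

Lemma minor_vanish (J : flag_index) (A : frame) :
  minor_vanish_at J (\pi_line_config A) <-> flag_minor J (val A) = 0.
Proof.
have [z z0 e] := repr_torus A; rewrite /minor_vanish_at /flag_minor.
set f := widen_ord _; set g := enum_val; set B := val (repr _).
have -> : mxsub f g B = mxsub f g (val A) *m diag_mx (\row_c z (g c)).
  by apply/matrixP => i j; rewrite mul_mx_diag !mxE e.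
rewrite det_mulmx det_diag; split=> [/eqP|->]; last by rewrite mul0r.
rewrite mulf_eq0 => /orP[/eqP //|] /eqP h.
suff: \prod_i (\row_c z (g c)) 0 i != 0 by rewrite h eqxx.
by apply/prodf_neq0 => j _; rewrite mxE.
Qed.

Implicit Type w : n.-tuple 'I_k.

Definition word_mx w : 'M[F]_(k, n) := \matrix_(r, j) (r == tnth w j)%:R.

Definition pattern w : set 'M[F]_(k, n) :=
  [set Y | forall r j, ~~ star w r j -> Y r j = word_mx w r j].

Definition lower_unitri : set 'M[F]_k :=
  [set X | (forall i, X i i = 1) /\ (forall i j : 'I_k, (i < j)%N -> X i j = 0)].

Definition PR_cell w : set line_config :=
  [set x | exists2 A : frame, x = \pi_line_config A &
     exists X Y, [/\ lower_unitri X, pattern w Y & val A = X *m Y]].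

Definition PR_variety w : set line_config := zariski_closure (PR_cell w).

Definition PR_flags w : set flag_index :=
  [set J | forall x, PR_cell w x -> minor_vanish_at J x].

End LineConfigurations.

Arguments PR_cell F {k n} w.
Arguments PR_variety F {k n} w.
Arguments PR_flags F {k n} w.

(* Main.v *)
Require Import Defs.
From mathcomp Require Import all_boot all_algebra.
From mathcomp Require Import boolp classical_sets reals.
From mathcomp Require Import complex mpoly.
From mathcomp Require Import perm zify.

(* Order the letters by first appearance and label column [j] with the position
   of the first occurrence of the letter [w_j].  Up to column scaling, the cell
   consists of the products [X Q] with [X] invertible lower triangular and [Q] of
   staircase shape: row [r] vanishes on the columns labelled before [r] appears,
   and is nonzero on the columns carrying the letter [r].  Every point of the cell
   satisfies the rank conditions
     rank (rows < q, columns labelled < m) <= #{r < q appearing before m}.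
   Conversely these conditions cut out the closure.  One inducts on the order of
   appearance: if [r] appears before [r+1], then a matrix satisfying the
   conditions is obtained by a row operation on the rows [r] and [r+1] from one
   satisfying the stronger conditions for the order in which [r] and [r+1] are
   exchanged, and such row operations map the smaller closure into the larger.
   If no such [r] is left, the conditions are linear and define the closure of
   the staircase matrices.
   Finally, on a matrix of rank [k] a failing rank condition is witnessed by a flag
   minor: extend a basis of the offending columns to a basis of all columns,
   truncated to the first [q] rows. *)

Set Implicit Arguments.
Unset Strict Implicit.
Unset Printing Implicit Defensive.

Import GRing.Theory Num.Theory.

Local Open Scope ring_scope.

(** * Zariski closure in the affine space of matrices *)

Section PolynomialClosure.
Variables (F : fieldType) (k n : nat).
Implicit Types (p : {mpoly F[k * n]}) (A B : 'M[F]_(k, n)).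
Implicit Types G : 'M[F]_(k, n) -> Prop.

Definition mx_closure G A : Prop :=
  forall p, (forall B, G B -> eval_mx p B = 0) -> eval_mx p A = 0.

Lemma eval_mx_curve p (C : 'M[{poly F}]_(k, n)) :
  exists u : {poly F}, forall t,
    u.[t] = eval_mx p (\matrix_(i, j) (C i j).[t]).
Proof.
exists (\sum_(m <- msupp p) p@_m *: \prod_v (mxvec C 0 v) ^+ m v) => t.
rewrite /eval_mx mevalE horner_sum; apply: eq_bigr => m _.
rewrite hornerZ; congr (_ * _); rewrite horner_prod; apply: eq_bigr => v _.
by rewrite horner_exp; case/mxvec_indexP: v => i j; rewrite !mxvecE mxE.
Qed.

(** Left multiplication by [N] is polynomial, so an equation [p] pulls back along it: [lq] lists the
    entries of [N] times the generic matrix. *)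
Lemma mx_closure_mulmx (N : 'M[F]_k) G G' A :
  (forall B, G B -> mx_closure G' (N *m B)) ->
  mx_closure G A -> mx_closure G' (N *m A).
Proof.
move=> NG clA p pG'.
pose lq : (k * n).-tuple {mpoly F[k * n]} :=
  [tuple mxvec (\matrix_(i, j) \sum_s N i s *: 'X_(mxvec_index s j)) 0 v
     | v < k * n].
have lqE B : eval_mx (p \mPo lq) B = eval_mx p (N *m B).
  rewrite /eval_mx comp_mpoly_meval; apply: meval_eq => v.
  rewrite tnth_mktuple; case/mxvec_indexP: v => i j.
  rewrite !mxvecE !mxE raddf_sum /=; apply: eq_bigr => s _.
  by rewrite mevalZ mevalXU mxvecE.
by rewrite -lqE; apply: clA => B GB; rewrite lqE; apply: NG GB _ pG'.
Qed.

End PolynomialClosure.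

(** * Limits along polynomial curves *)

Section CurvesThroughCells.
Variables (F : numFieldType) (k n : nat).
Implicit Types (p : {mpoly F[k * n]}) (A B : 'M[F]_(k, n)).

Lemma poly_infinite_roots (u : {poly F}) : (forall t, u.[t] = 0) -> u = 0.
Proof.
move=> u0; apply/eqP; apply: contraT => nz.
have := @max_poly_roots _ u [seq i%:R | i <- iota 0 (size u)] nz.
rewrite size_map size_iota ltnn; apply.
  by apply/allP => t _; apply/rootP.
rewrite map_inj_in_uniq ?iota_uniq // => i j _ _ /eqP.
by rewrite eqr_nat => /eqP.
Qed.

(** Along the curve [p] becomes a univariate polynomial [u], and [u * d] vanishes at every point of
    an infinite field. *)
Lemma eval_mx_curve_eq0 p (C : 'M[{poly F}]_(k, n)) (d : {poly F}) : d != 0 ->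
  (forall t, d.[t] != 0 -> eval_mx p (\matrix_(i, j) (C i j).[t]) = 0) ->
  forall t, eval_mx p (\matrix_(i, j) (C i j).[t]) = 0.
Proof.
move=> d0 pC t; have [u uE] := eval_mx_curve p C; rewrite -uE.
suff -> : u = 0 by rewrite horner0.
have /eqP : u * d = 0.
  apply: poly_infinite_roots => s; rewrite hornerM.
  have [->|ds] := eqVneq d.[s] 0; first by rewrite mulr0.
  by rewrite uE pC // mul0r.
by rewrite mulf_eq0 (negPf d0) orbF => /eqP.
Qed.

Lemma eval_mx_line_eq0 p A W (d : {poly F}) : d != 0 ->
  (forall t, d.[t] != 0 -> eval_mx p (A + t *: W) = 0) -> eval_mx p A = 0.
Proof.
move=> d0 pA.
pose C : 'M[{poly F}]_(k, n) := \matrix_(i, j) ((A i j)%:P + 'X * (W i j)%:P).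
have CE t : (\matrix_(i, j) (C i j).[t]) = A + t *: W.
  by apply/matrixP => i j; rewrite !mxE !hornerE.
have := @eval_mx_curve_eq0 p C d d0.
move=> /(_ _ 0); rewrite CE scale0r addr0; apply=> t dt.
by rewrite CE pA.
Qed.

End CurvesThroughCells.

Lemma polyXaddC_neq0 (R : nzRingType) (a : R) : 'X + a%:P != 0.
Proof. by rewrite -[a]opprK polyCN polyXsubC_eq0. Qed.

(** * Staircase matrices and the rank conditions *)

Section StaircaseCells.
Variables (F : fieldType) (k n : nat) (c : 'I_n -> nat).
Implicit Types (f : 'I_k -> nat) (A Q : 'M[F]_(k, n)) (N X : 'M[F]_k).

(* Column [j] carries the label [c j] and row [r] the label [f r]; columns are
   filtered by their labels, and [f] lists the rows in their order of appearance. *)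
Definition staircase f Q : Prop :=
  (forall r j, Q r j != 0 -> (f r <= c j)%N) /\
  (forall r j, f r = c j -> Q r j != 0).

Definition staircase_cell f A : Prop :=
  exists X Q, [/\ is_trig_mx X, X \in unitmx, staircase f Q & A = X *m Q].

Definition top_rows q A : 'M[F]_(k, n) :=
  \matrix_(i, j) if (i < q)%N then A i j else 0.

Definition col_filter m : 'M[F]_n := diag_mx (\row_j (c j < m)%N%:R).

Definition rank_bound f q m := #|[pred r : 'I_k | (r < q)%N && (f r < m)%N]|.

Definition rank_variety f A : Prop :=
  forall q m, (\rank (top_rows q A *m col_filter m) <= rank_bound f q m)%N.

(** For [r' = r + 1], the invertible such matrices form the minimal parabolic subgroup over the
    lower triangular group. *)
Definition parabolic (r r' : 'I_k) N : Prop :=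
  forall i j : 'I_k, (i < j)%N -> (i, j) != (r, r') -> N i j = 0.

(** Factor [N *m Q] as [(N *m E') *m (E *m Q)]: the pivot [N r r] lets [E'] clear the only entry
    above the diagonal, and [E] adds a multiple of row [r'] to row [r], which is harmless because
    [r] appears before [r']. *)
Lemma staircase_cell_parabolic f (r r' : 'I_k) N Q :
  r' = r.+1 :> nat -> (f r < f r')%N -> staircase f Q -> parabolic r r' N ->
  N r r != 0 -> N \in unitmx -> staircase_cell f (N *m Q).
Proof.
move=> r'E ltf [Qf Qp] Npar Nr Nu.
have rr' : r' != r by rewrite -val_eqE /= r'E; lia.
set a := N r r' / N r r.
pose E : 'M[F]_k := 1%:M + a *: delta_mx r r'.
pose E' : 'M[F]_k := 1%:M - a *: delta_mx r r'.
have E'E : E' *m E = 1%:M.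
  rewrite /E /E' mulmxDr mulmx1 mulmxBl mul1mx -scalemxAl -!scalemxAr.
  by rewrite mul_delta_mx_0 // !scaler0 subr0 subrK.
have LE i j : (N *m E') i j = N i j - a * N i r *+ (j == r').
  rewrite /E' mulmxBr mulmx1 mxE [X in _ + X]mxE -scalemxAr; congr (_ - _).
  rewrite !mxE (bigD1 r) //= big1 ?addr0 => [|s /negPf sr].
    rewrite mxE eqxx /=; case: eqP => _; last by rewrite !mulr0.
    by rewrite mulr1 mulr1n.
  by rewrite mxE sr mulr0.
have QE i j : (E *m Q) i j = Q i j + a * Q r' j *+ (i == r).
  rewrite /E mulmxDl mul1mx mxE -scalemxAl; congr (_ + _).
  rewrite !mxE (bigD1 r') //= big1 ?addr0 => [|s /negPf sr].
    rewrite mxE eqxx andbT; case: eqP => _; last by rewrite !(mul0r, mulr0).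
    by rewrite mul1r.
  by rewrite mxE sr andbF mul0r.
exists (N *m E'), (E *m Q); split.
- apply/is_trig_mxP => i j ij; rewrite LE.
  case: (eqVneq j r') => [jr|jr]; last first.
    by rewrite mulr0n subr0 Npar // xpair_eqE negb_and jr orbT.
  case: (eqVneq i r) => [->|ir].
    by rewrite jr mulr1n /a divfK // subrr.
  rewrite (Npar i j) ?xpair_eqE ?negb_and ?ir // sub0r.
  rewrite (Npar i r) ?mulr0 ?mul0rn ?oppr0 //.
    by move: ij ir; rewrite jr r'E -val_eqE /=; lia.
  by rewrite xpair_eqE negb_and ir.
- by rewrite unitmx_mul Nu; have /mulmx1_unit[] := E'E.
- split=> i j.
    rewrite QE; have [->|_] := eqVneq i r; last first.
      by rewrite mulr0n addr0; apply: Qf.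
    have [q0|q0 _] := eqVneq (Q r' j) 0; first by rewrite q0 mulr0 addr0 => /Qf.
    by apply: leq_trans (ltnW ltf) (Qf _ _ q0).
  move=> fc; rewrite QE; have [ir|_] := eqVneq i r; last first.
    by rewrite addr0; apply: Qp.
  suff -> : Q r' j = 0 by rewrite mulr0 addr0; apply: Qp.
  by apply: contraTeq ltf => /Qf; rewrite -leqNgt -fc ir.
- by rewrite mulmxA -(mulmxA N) E'E mulmx1.
Qed.

End StaircaseCells.

(** * Closures of staircase cells: parabolic moves and the linear case *)

Section StaircaseClosures.
Variables (F : numFieldType) (k n : nat) (c : 'I_n -> nat).
Implicit Types (f : 'I_k -> nat) (A Q : 'M[F]_(k, n)) (N X : 'M[F]_k).
Local Notation staircase := (staircase c).
Local Notation staircase_cell := (staircase_cell c).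
Local Notation rank_variety := (rank_variety c).

Lemma staircase_closure_parabolic f (r r' : 'I_k) N Q :
  r' = r.+1 :> nat -> (f r < f r')%N -> staircase f Q -> parabolic r r' N ->
  mx_closure (staircase_cell f) (N *m Q).
Proof.
move=> r'E ltf Qf Npar p pG.
(* Replace [N] by [N + t]: the roots of the first factor are the [t] making it singular, that of the
   second the [t] killing its entry at [(r, r)]. *)
apply: (@eval_mx_line_eq0 _ _ _ p (N *m Q) Q (char_poly (- N) * ('X + (N r r)%:P))).
  by apply: mulf_neq0 (polyXaddC_neq0 _); apply/monic_neq0/char_poly_monic.
move=> t; rewrite hornerM mulf_eq0 negb_or => /andP[dN]; rewrite !hornerE => tN.
rewrite -[X in t *: X]mul1mx scalemxAl -mulmxDl; apply: pG.
have NE i j : (N + t *: 1%:M) i j = N i j + t *+ (i == j).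
  by rewrite !mxE mulr_natr.
apply: (staircase_cell_parabolic r'E ltf Qf).
- move=> i j ij ne; rewrite NE Npar //.
  by rewrite -val_eqE /= ltn_eqF // addr0.
- by rewrite NE eqxx addrC.
- rewrite unitmxE unitfE; move: dN; rewrite /char_poly -horner_evalE -det_map_mx.
  congr (\det _ != 0); apply/matrixP => i j.
  rewrite !mxE /= /horner_eval !hornerE hornerMn hornerX addrC opprK.
  by rewrite mulr_natr.
Qed.

Lemma rank_variety_closure_antitone f A :
  (forall r s : 'I_k, (r <= s)%N -> (f s <= f r)%N) -> rank_variety f A ->
  mx_closure (staircase_cell f) A.
Proof.
move=> fdec Af p pG.
(* Moving along [W] makes all entries with [f r = c j] nonzero for generic [t]; the required zeros
   of [A] lie outside the support of [W]. *)
pose W : 'M[F]_(k, n) := \matrix_(r, j) (f r == c j)%:R.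
pose d := \prod_(rj : 'I_k * 'I_n) ('X + (A rj.1 rj.2)%:P).
apply: (@eval_mx_line_eq0 _ _ _ p A W d).
  by apply/prodf_neq0 => rj _; apply: polyXaddC_neq0.
move=> t; rewrite horner_prod => /prodf_neq0 dt; apply: pG.
exists 1%:M, (A + t *: W); split.
- exact: scalar_mx_is_trig.
- exact: unitmx1.
- split=> r j; rewrite !mxE; last first.
    by move=> ->; rewrite eqxx mulr1 addrC; have := dt (r, j) isT; rewrite !hornerE.
  case: leqP => // cf; rewrite (gtn_eqF cf) mulr0 addr0.
  suff -> : A r j = 0 by rewrite eqxx.
  (* No row is counted here: each [s <= r] has [f s >= f r > c j]. The rank condition thus forces
     [A r j = 0]. *)
  have := Af r.+1 (c j).+1; rewrite /rank_bound eq_card0.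
    rewrite leqn0 mxrank_eq0 => /eqP /matrixP /(_ r j).
    by rewrite mul_mx_diag !mxE !ltnSn mulr1.
  move=> s; rewrite !inE !ltnS; apply/negP => /andP[sr fs].
  by have := leq_trans cf (leq_trans (fdec _ _ sr) fs); rewrite ltnn.
- by rewrite mul1mx.
Qed.

End StaircaseClosures.

(** * Rank conditions under the exchange of adjacent rows *)

Section RankVarieties.
Variables (F : fieldType) (k n : nat) (c : 'I_n -> nat).
Implicit Types (f : 'I_k -> nat) (A Q : 'M[F]_(k, n)) (N X : 'M[F]_k).
Local Notation col_filter := (col_filter F c).
Local Notation rank_variety := (rank_variety c).
Local Notation staircase_cell := (staircase_cell c).

Lemma row_top_rows q A (i : 'I_k) :
  row i (top_rows q A) = if (i < q)%N then row i A else 0.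
Proof. by apply/rowP => j; rewrite !mxE; case: ifP; rewrite ?mxE. Qed.

Lemma sub_top_rows q A (i : 'I_k) : (i < q)%N -> (row i A <= top_rows q A)%MS.
Proof. by move=> iq; have := row_sub i (top_rows q A); rewrite row_top_rows iq. Qed.

Lemma top_rows_subP q A m (V : 'M[F]_(m, n)) :
  reflect (forall i : 'I_k, (i < q)%N -> (row i A <= V)%MS)
          (top_rows q A <= V)%MS.
Proof.
apply: (iffP row_subP) => [AV i iq|AV i].
  by have := AV i; rewrite row_top_rows iq.
by rewrite row_top_rows; case: ifP => [/AV //|_]; apply: sub0mx.
Qed.

Lemma col_filter_mul m m' : (m' <= m)%N ->
  col_filter m *m col_filter m' = col_filter m'.
Proof.
move=> m'm; rewrite mulmx_diag; congr diag_mx; apply/rowP => j.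
rewrite !mxE; case: (ltnP (c j) m') => [/leq_trans -> //|_].
  by rewrite mulr1.
by rewrite mulr0.
Qed.

Section AdjacentSwap.
Variables (f : 'I_k -> nat) (r r' : 'I_k).
Hypothesis r'E : r' = r.+1 :> nat.
Let s := tperm r r'.

Lemma adjacent_tperm_lt (i j : 'I_k) :
  (i < j)%N -> (i, j) != (r, r') -> (s i < s j)%N.
Proof.
rewrite xpair_eqE -!val_eqE /= /s => ij ne.
by case: tpermP => [ir|ir|/eqP ir /eqP ir']; case: tpermP => [jr|jr|/eqP jr /eqP jr'];
  move: ij ne; rewrite ?ir ?jr -?val_eqE /=; move: r'E;
  try move: ir ir'; try move: jr jr'; rewrite -?val_eqE /=; lia.
Qed.

(** Unless [q = r + 1], the first [q] rows contain both or neither of [r] and [r']. *)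
Lemma adjacent_tperm_top (i : 'I_k) q : q != r.+1 -> (s i < q)%N = (i < q)%N.
Proof.
move=> qr; rewrite /s; case: tpermP => [->|->|//]; move: qr r'E; lia.
Qed.

Lemma rank_bound_swap q m : q != r.+1 -> rank_bound (f \o s) q m = rank_bound f q m.
Proof.
move=> qr; rewrite /rank_bound -!sum1_card [RHS](reindex_inj (@perm_inj _ s)) /=.
by apply: eq_bigl => i; rewrite !inE adjacent_tperm_top.
Qed.

Lemma rank_bound_swapS m :
  rank_bound (f \o s) r.+1 m = (rank_bound f r m + (f r' < m))%N.
Proof.
rewrite /rank_bound (cardD1 r) !inE /= /s tpermL ltnSn /= addnC; congr (_ + _)%N.
apply: eq_card => i; rewrite !inE ltnS leq_eqVlt val_eqE.
have [->|ir] := eqVneq i r; first by rewrite ltnn.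
rewrite /=; case: (ltnP i r) => //= ltir.
by rewrite tpermD // -val_eqE /=; move: ltir; rewrite ?r'E; lia.
Qed.

Lemma rank_boundSS m : (m <= f r')%N ->
  (rank_bound f r.+2 m <= (rank_bound f r m).+1)%N.
Proof.
move=> mf; rewrite /rank_bound (cardD1 r).
apply: leq_trans (leq_add (leq_b1 _) (leqnn _)) _; rewrite add1n ltnS.
apply/subset_leq_card/fintype.subsetP => i; rewrite !inE => /andP[ir /andP[ir2 fm]].
rewrite fm andbT; have : i != r'.
  by apply: contraTneq fm => ->; rewrite -leqNgt.
by move: ir ir2; rewrite -!val_eqE /= r'E; lia.
Qed.

(** Only the bounds at [q = r + 1] need work. There row [r] of [B] raises the rank by at most one:
    for [m > f r'] the new bound allows this, for [m0 < m <= f r'] the strict inequality absorbs it,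
    and for [m <= m0] the row adds nothing. *)
Lemma rank_variety_swap A B m0 :
  rank_variety f A ->
  (forall q, q != r.+1 -> (top_rows q B <= top_rows q A)%MS) ->
  (row r B *m col_filter m0 <= top_rows r A *m col_filter m0)%MS ->
  (forall m, (m0 < m <= f r')%N ->
     (\rank (top_rows r A *m col_filter m) < rank_bound f r m)%N) ->
  rank_variety (f \o s) B.
Proof.
move=> fA BA rB ltA q m.
have [->|qr] := eqVneq q r.+1; last first.
  by rewrite rank_bound_swap // (leq_trans _ (fA q m)) ?mxrankS ?submxMr ?BA.
have BV : (top_rows r.+1 B *m col_filter m <=
           top_rows r A *m col_filter m + row r B *m col_filter m)%MS.
  rewrite -addsmxMr submxMr //; apply/top_rows_subP => i.
  rewrite ltnS leq_eqVlt val_eqE => /orP[/eqP ->|ir]; first exact: addsmxSr.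
  apply: submx_trans (addsmxSl _ _); apply: submx_trans (sub_top_rows _ ir) (BA _ _).
  by rewrite neq_ltn ltnSn.
have rank1 : (\rank (row r B *m col_filter m) <= 1)%N := rank_leq_row _.
have rankB : (\rank (top_rows r.+1 B *m col_filter m) <=
              \rank (top_rows r A *m col_filter m) + 1)%N.
  apply: leq_trans (mxrankS BV) _; apply: leq_trans (mxrank_adds_leqif _ _) _.
  by rewrite leq_add2l.
rewrite rank_bound_swapS; case: ltnP => mf.
  by rewrite (leq_trans rankB) // leq_add2r fA.
rewrite addn0; have [mm0|m0m] := leqP m m0; last first.
  by rewrite (leq_trans rankB) // addn1 ltA ?m0m.
apply: leq_trans (fA r m); apply: mxrankS; apply: submx_trans BV _.
rewrite addsmx_sub submx_refl /=.
by have := submxMr (col_filter m) rB; rewrite -!mulmxA col_filter_mul.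
Qed.

Lemma staircase_swap Q : staircase c (f \o s) Q -> staircase c f (perm_mx s *m Q).
Proof.
case=> Qf Qp; rewrite -row_permE; split=> i j; rewrite mxE.
  by move=> /Qf; rewrite /= /s tpermK.
by move=> fc; apply: Qp; rewrite /= /s tpermK.
Qed.

Lemma mul_perm_swapE X i j : (X *m perm_mx s) i j = X i (s j).
Proof. by rewrite /s -{1}(tpermV r r') -col_permE mxE. Qed.

Lemma parabolic_mul_perm X : is_trig_mx X -> parabolic r r' (X *m perm_mx s).
Proof.
move=> /is_trig_mxP Xt i j ij ne; rewrite mul_perm_swapE; apply: Xt.
case: (eqVneq j r') => [jr|jr].
  rewrite jr /s tpermR; move: ij ne; rewrite jr xpair_eqE eqxx andbT -val_eqE /= r'E.
  lia.
rewrite /s; case: tpermP ij => [->|/eqP|_ _ //]; last by rewrite (negPf jr).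
rewrite r'E; lia.
Qed.

Lemma parabolic_conj_perm X :
  is_trig_mx X -> parabolic r r' (perm_mx s *m (X *m perm_mx s)).
Proof.
move=> /is_trig_mxP Xt i j ij ne; rewrite -row_permE mxE mul_perm_swapE.
exact/Xt/adjacent_tperm_lt.
Qed.

Hypothesis ltf : (f r < f r')%N.

(* The row that becomes the [r]-th one has to lie in the span of the rows above
   it on as long an initial range of columns as possible: up to the last filter
   level [m0 <= f r'] at which the rank bound of the rows above is attained. *)
Lemma rank_variety_descent A : rank_variety f A ->
  rank_variety (f \o s) A \/
  exists x, rank_variety (f \o s)
    (perm_mx s *m ((1%:M - x *: delta_mx r' r) *m A)).
Proof.
move=> fA.
pose P m := (m <= f r')%N &&
  (\rank (top_rows r A *m col_filter m) == rank_bound f r m).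
have P0 : exists m, P m.
  exists 0%N; rewrite /P leq0n /= /rank_bound [X in _ == X]eq_card0 => [|i].
    rewrite mxrank_eq0; apply/eqP/matrixP => i j.
    by rewrite mul_mx_diag !mxE mulr0.
  by rewrite !inE andbF.
have Pf m : P m -> (m <= f r')%N by case/andP.
case: (ex_maxnP P0 Pf) => m0 /andP[m0f /eqP rk0] max0.
have lt0 m : (m0 < m <= f r')%N ->
    (\rank (top_rows r A *m col_filter m) < rank_bound f r m)%N.
  case/andP=> m0m mf; rewrite ltn_neqAle fA andbT.
  by apply: contraTneq m0m => rkm; rewrite -leqNgt max0 // /P mf rkm eqxx.
set V := top_rows r A *m col_filter m0.
have [rV|rV] := boolP (row r A *m col_filter m0 <= V)%MS.
  by left; apply: (@rank_variety_swap A A m0).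
right; have r2 : (r < r.+2)%N by [].
have r'2 : (r' < r.+2)%N by rewrite r'E.
pose W := top_rows r.+2 A *m col_filter m0.
have VW : (V + row r A *m col_filter m0 <= W)%MS.
  rewrite addsmx_sub !submxMr ?sub_top_rows //; apply/top_rows_subP => i ir.
  by rewrite sub_top_rows // ltnW // ltnW.
(* [W] has rank at most [\rank V + 1] because [V] attains its bound, and row [r], lying outside [V],
   already supplies the extra dimension. *)
have WV : (W <= V + row r A *m col_filter m0)%MS.
  rewrite -(geq_leqif (mxrank_leqif_sup VW)).
  apply: leq_trans (fA _ _) _; apply: leq_trans (rank_boundSS m0f) _.
  rewrite -rk0; apply: rank_ltmx; rewrite /ltmx addsmxSl /=.
  by apply: contra rV => /(submx_trans (addsmxSr _ _)).
have : (row r' A *m col_filter m0 <= V + row r A *m col_filter m0)%MS.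
  by apply: submx_trans WV; rewrite submxMr ?sub_top_rows.
case/sub_addsmxP=> -[u v] /= uv.
(* This is the coefficient of row [r] in row [r'] modulo [V]: subtracting that multiple puts row
   [r'] into [V], and the exchange then moves it to place [r]. *)
exists (v 0 0).
have LE i : row i ((1%:M - v 0 0 *: delta_mx r' r) *m A) =
    row i A - (v 0 0 *: row r A) *+ (i == r').
  apply/rowP => j; rewrite mulmxBl mul1mx -scalemxAl !mxE; congr (_ - _).
  rewrite (bigD1 r) //= big1 ?addr0 => [|t /negPf tr].
    rewrite !mxE eqxx andbT; case: eqP => _; last by rewrite mul0r mulr0 mulr0n mxE.
    by rewrite mul1r mulr1n !mxE.
  by rewrite !mxE tr andbF mul0r.
have rowS B i : row i (perm_mx s *m B) = row (s i) B :> 'rV[F]_n.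
  by rewrite -row_permE; apply/rowP => j; rewrite !mxE.
apply: (@rank_variety_swap A _ m0) => //.
  move=> q qr; apply/top_rows_subP => i iq.
  rewrite rowS LE.
  have sq : (s i < q)%N by rewrite adjacent_tperm_top.
  case: eqP => [sr'|_]; last by rewrite mulr0n subr0 sub_top_rows.
  rewrite mulr1n addmx_sub ?sub_top_rows // eqmx_opp scalemx_sub //.
  rewrite sub_top_rows //; move: sq qr; rewrite sr' r'E; lia.
rewrite rowS /s tpermL LE eqxx mulr1n mulmxBl uv -scalemxAl.
by rewrite {1}[v]mx11_scalar mul_scalar_mx addrK submxMl.
Qed.

End AdjacentSwap.

Lemma parabolic_trig_mul (r r' : 'I_k) X N : r' = r.+1 :> nat ->
  is_trig_mx X -> parabolic r r' N -> parabolic r r' (X *m N).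
Proof.
move=> r'E /is_trig_mxP Xt Npar i j ij ne; rewrite mxE big1 // => t _.
have [it|ti] := ltnP i t; first by rewrite Xt // mul0r.
rewrite (Npar t j) ?mulr0 //; first exact: leq_ltn_trans ti ij.
apply: contraNneq ne => -[tr jr]; rewrite jr xpair_eqE eqxx andbT -val_eqE /=.
by move: ti ij; rewrite tr jr r'E; lia.
Qed.

End RankVarieties.

(* Induction on [\sum_r r * f r]: exchanging two consecutive values of [f] that
   increase lowers it, and the bottom case is a linear space. *)
Theorem rank_variety_closure (F : numFieldType) (k n : nat) (c : 'I_n -> nat)
    (f : 'I_k -> nat) (A : 'M[F]_(k, n)) :
  rank_variety c f A -> mx_closure (staircase_cell c f) A.
Proof.
have [N] := ubnP (\sum_(r < k) r * f r); elim: N => // N IHN in f A *.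
rewrite ltnS => leN fA.
have [/existsP[r /existsP[r' /andP[/eqP r'E ltf]]]|/existsPn fdec] :=
  boolP [exists r : 'I_k, exists r' : 'I_k, (r' == r.+1 :> nat) && (f r < f r')%N];
  last first.
  apply: rank_variety_closure_antitone fA => r r1.
  have [d] := ubnP (r1 - r); elim: d => // d IHd in r r1 *.
  rewrite ltnS => led; rewrite leq_eqVlt => /orP[/eqP/ord_inj -> //|lt1].
  have rk : (r.+1 < k)%N by apply: leq_ltn_trans lt1 _.
  have /existsPn/(_ (Ordinal rk)) := fdec r.
  rewrite eqxx /= -leqNgt; apply: leq_trans; apply: IHd => //=.
  by move: led lt1; lia.
set s := tperm r r'.
have lt_s : (\sum_(i < k) i * (f \o s) i < N)%N.
  apply: leq_trans leN; have rr' : r' != r by rewrite -val_eqE /= r'E; lia.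
  rewrite (bigD1 r) //= (bigD1 r') //= [X in (_ < X)%N](bigD1 r) //=.
  rewrite [X in (_ < _ + X)%N](bigD1 r') //= /s tpermL tpermR !addnA.
  under eq_bigr => i /andP[ir ir'] do rewrite tpermD 1?eq_sym //.
  by rewrite ltn_add2r r'E; nia.
(* Inserting [perm_mx s *m perm_mx s] before [Q] turns it into a staircase matrix for [f]; the
   remaining left factors [L X s] and [L s X s] are parabolic. *)
have clX (X : 'M[F]_k) (Q : 'M[F]_(k, n)) : is_trig_mx X -> staircase c (f \o s) Q ->
    forall L, is_trig_mx L ->
    mx_closure (staircase_cell c f) (L *m (X *m Q)) /\
    mx_closure (staircase_cell c f) (L *m perm_mx s *m (X *m Q)).
  move=> Xt sQ L Lt.
  have ss : perm_mx s *m perm_mx s = 1%:M :> 'M[F]_k.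
    by rewrite -perm_mxM tperm2 perm_mx1.
  have fQ := staircase_swap sQ.
  rewrite -[Q]mul1mx -ss -(mulmxA _ _ Q) (mulmxA X) -(mulmxA L (perm_mx s)).
  rewrite (mulmxA (perm_mx s)) !(mulmxA L _ (perm_mx s *m Q)).
  split; apply: (staircase_closure_parabolic r'E ltf fQ); apply: parabolic_trig_mul => //.
    exact: parabolic_mul_perm.
  exact: parabolic_conj_perm.
have [sA|[x sA]] := rank_variety_descent r'E ltf fA.
  rewrite -[A]mul1mx; apply: mx_closure_mulmx (IHN _ _ lt_s sA) => _ [X [Q [Xt _ sQ ->]]].
  by have [] := clX X Q Xt sQ 1%:M (scalar_mx_is_trig _ _).
set L : 'M[F]_k := 1%:M - _ in sA; pose L' : 'M[F]_k := 1%:M + x *: delta_mx r' r.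
have L'L : L' *m L = 1%:M.
  rewrite /L /L' mulmxBr mulmx1 mulmxDl mul1mx -scalemxAl -!scalemxAr.
  rewrite mul_delta_mx_0 ?scaler0 ?addr0 ?addrK //.
  by rewrite -val_eqE /= r'E ltn_eqF.
have L't : is_trig_mx L'.
  apply/is_trig_mxP => i j ij; rewrite !mxE -!val_eqE /= (ltn_eqF ij) add0r r'E.
  by case: eqP => [ir|_]; rewrite ?mulr0 //; case: eqP => [jr|_]; rewrite ?mulr0 //; lia.
have -> : A = L' *m perm_mx s *m (perm_mx s *m (L *m A)).
  rewrite !mulmxA -(mulmxA L') -perm_mxM tperm2 perm_mx1 mulmx1 L'L.
  by rewrite mul1mx.
apply: mx_closure_mulmx (IHN _ _ lt_s sA) => _ [X [Q [Xt _ sQ ->]]].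
by have [] := clX X Q Xt sQ L' L't.
Qed.

(** * Flag minors as witnesses for the rank conditions *)

Section FlagMinors.
Variables (F : fieldType) (k n : nat) (c : 'I_n -> nat).
Implicit Types (f : 'I_k -> nat) (A Q : 'M[F]_(k, n)) (J : flag_index k n).
Local Notation col_filter := (col_filter F c).
Local Notation rank_variety := (rank_variety c).

Lemma rank_leq_nonzero_rows m p (P : pred 'I_m) (B : 'M[F]_(m, p)) :
  (forall i, ~~ P i -> row i B = 0) -> (\rank B <= #|P|)%N.
Proof.
move=> B0; apply: leq_trans (rank_leq_row (rowsub (enum_val : 'I_#|P| -> 'I_m) B)).
apply/mxrankS/row_subP => i; have [Pi|/B0 ->] := boolP (P i); last exact: sub0mx.
by rewrite -[i in row i](enum_rankK_in Pi Pi) -row_rowsub row_sub.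
Qed.

(** The first [q] rows of [X *m Q] are combinations of those of [Q], and a row [r] of [Q] survives
    the column filter only if [f r < m]. *)
Lemma staircase_rank_variety f X Q : is_trig_mx X ->
  (forall r j, Q r j != 0 -> (f r <= c j)%N) -> rank_variety f (X *m Q).
Proof.
move=> /is_trig_mxP Xt Qf q m.
apply: (@leq_trans (\rank (top_rows q Q *m col_filter m))).
  apply/mxrankS/submxMr/top_rows_subP => i iq.
  rewrite row_mul mulmx_sum_row summx_sub // => t _; rewrite mxE.
  have [it|ti] := ltnP i t; first by rewrite Xt // scale0r sub0mx.
  by rewrite scalemx_sub // sub_top_rows // (leq_ltn_trans ti).
apply: rank_leq_nonzero_rows => r; rewrite /= negb_and -!leqNgt => rqm.
apply/rowP => j; rewrite mul_mx_diag !mxE; case: ltnP => rq; last by rewrite mul0r.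
move: rqm; rewrite leqNgt rq /= => mf.
have [->|/Qf fc] := eqVneq (Q r j) 0; first by rewrite mul0r.
by rewrite ltnNge (leq_trans mf fc) mulr0.
Qed.

(** The columns of an invertible submatrix that pass the filter are independent. Their number is
    bounded through the complementary projections [d true] and [d false], whose ranks add up to at
    least [#|J|]. *)
Lemma flag_minor_rank A J m : flag_minor J A != 0 ->
  (\sum_(j in val J) (c j < m) <= \rank (top_rows #|val J| A *m col_filter m))%N.
Proof.
rewrite /flag_minor; set h := widen_ord _; set g := enum_val => M0.
have Mu : mxsub h g A \in unitmx by rewrite unitmxE unitfE.
pose d (b : bool) : 'M[F]_#|val J| := diag_mx (\row_a ((c (g a) < m)%N == b)%:R).
have MD : mxsub h g (A *m col_filter m) = mxsub h g A *m d true.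
  by apply/matrixP => i a; rewrite mxE !mul_mx_diag !mxE eqb_id.
have rkM : (\rank (d true) <= \rank (top_rows #|val J| A *m col_filter m))%N.
  have fullM : row_full (mxsub h g A) by rewrite row_full_unit.
  rewrite -(eqmxMfull (d true) fullM) -MD.
  have -> : mxsub h g (A *m col_filter m) =
      rowsub h (A *m col_filter m) *m colsub g 1%:M.
    by rewrite mulmx_colsub mulmx1 -mxsub_comp.
  apply: leq_trans (mxrankM_maxl _ _) _; apply/mxrankS/row_subP => i.
  by rewrite row_rowsub row_mul submxMr // sub_top_rows //=.
apply: leq_trans rkM; rewrite big_enum_val.
have dd : d true + d false = 1%:M.
  apply/matrixP => i a; rewrite !mxE -mulrnDl; congr (_ *+ _).
  by case: (_ < _)%N; rewrite ?addr0 ?add0r.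
have := mxrank_add (d true) (d false); rewrite dd mxrank1 => rkd.
have : (\rank (d false) <= #|[pred a | (c (g a) < m)%N == false]|)%N.
  apply: rank_leq_nonzero_rows => i /= /negPf ci; apply/rowP => a.
  by rewrite !mxE ci mul0rn.
have -> : #|[pred a | (c (g a) < m)%N == false]| =
    (\sum_(a < #|val J|) (if (c (g a) < m)%N == false then 1 else 0))%N.
  by rewrite -[LHS]sum1_card big_mkcond.
have : (\sum_(a < #|val J|) (c (g a) < m) +
        \sum_(a < #|val J|) (if (c (g a) < m)%N == false then 1 else 0) = #|val J|)%N.
  rewrite -big_split /=; transitivity (\sum_(a < #|val J|) 1)%N; last first.
    by rewrite sum1_card card_ord.
  by apply: eq_bigr => a _; case: (_ < _)%N.
move: rkd; set a1 := (\sum_(_ < _) _)%N; set a2 := (\sum_(_ < _) _)%N; lia.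
Qed.

Definition row_filter p (B : 'M[F]_(n, p)) (S : {set 'I_n}) : 'M[F]_(n, p) :=
  \matrix_(i, j) if i \in S then B i j else 0.

Lemma row_row_filter p (B : 'M[F]_(n, p)) (S : {set 'I_n}) i :
  row i (row_filter B S) = if i \in S then row i B else 0.
Proof. by apply/rowP => j; rewrite !mxE; case: ifP; rewrite ?mxE. Qed.

Lemma row_filter_subP p (B : 'M[F]_(n, p)) (S : {set 'I_n}) q (V : 'M[F]_(q, p)) :
  reflect (forall i, i \in S -> (row i B <= V)%MS) (row_filter B S <= V)%MS.
Proof.
apply: (iffP row_subP) => [BV i iS|BV i].
  by have := BV i; rewrite row_row_filter iS.
by rewrite row_row_filter; case: ifP => [/BV //|_]; apply: sub0mx.
Qed.

Lemma sub_row_filter p (B : 'M[F]_(n, p)) (S : {set 'I_n}) i :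
  i \in S -> (row i B <= row_filter B S)%MS.
Proof. by move=> iS; have := row_sub i (row_filter B S); rewrite row_row_filter iS. Qed.

Lemma rank_row_filter p (B : 'M[F]_(n, p)) S : (\rank (row_filter B S) <= #|S|)%N.
Proof. by apply: rank_leq_nonzero_rows => i iS; rewrite row_row_filter ifN. Qed.

(** Steinitz extension: a maximal independent family inside [S] spans all rows indexed by [S]. *)
Lemma free_rows_extend p (B : 'M[F]_(n, p)) (J0 S : {set 'I_n}) :
  J0 \subset S -> \rank (row_filter B J0) = #|J0| ->
  exists J : {set 'I_n}, [/\ J0 \subset J, J \subset S,
    \rank (row_filter B J) = #|J| & (row_filter B S <= row_filter B J)%MS].
Proof.
move=> J0S freeJ0.
pose P (J : {set 'I_n}) := (J \subset S) && (\rank (row_filter B J) == #|J|).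
have PJ0 : P J0 by rewrite /P J0S freeJ0 eqxx.
have [J /maxsetP[/andP[JS /eqP freeJ] maxJ] J0J] := maxset_exists PJ0.
exists J; split=> //; apply/row_filter_subP => i iS.
apply: contraT => iJ.
have JiJ : J \subset i |: J by apply: finset.subsetUr.
suff /maxJ/(_ JiJ) eJ : P (i |: J).
  by case/negP: iJ; apply: sub_row_filter; rewrite -eJ finset.setU11.
rewrite /P finset.subUset finset.sub1set iS JS /= eqn_leq rank_row_filter /=.
rewrite cardsU1; have -> : i \notin J by apply: contra iJ => /sub_row_filter.
rewrite add1n -freeJ; apply: rank_ltmx; rewrite /ltmx; apply/andP; split.
  by apply/row_filter_subP => j jJ; rewrite sub_row_filter // finset.setU1r.
apply: contra iJ; apply: submx_trans.
by rewrite sub_row_filter ?finset.setU11.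
Qed.

Lemma flag_minor_basis A q m : (0 < q <= k)%N -> \rank A = k ->
  exists2 J : flag_index k n, #|val J| = q & flag_minor J A != 0 /\
    (\rank (top_rows q A *m col_filter m) <= \sum_(j in val J) (c j < m))%N.
Proof.
(* Columns of [A] become rows of [B], of rank [q] since [A] has full row rank. [J1] is a basis among
   the columns labelled below [m], and [J] extends it to all columns. *)
move=> /andP[q0 qk] rkA; pose B := (top_rows q A)^T.
have rkB : \rank B = q.
  rewrite mxrank_tr; have -> : top_rows q A = (pid_mx q : 'M_k) *m A.
    apply/matrixP => i j; rewrite !mxE (bigD1 i) //= big1 => [|t ti].
      by rewrite !mxE eqxx; case: (_ < _)%N; rewrite ?mul1r ?mul0r addr0.
    by rewrite !mxE eq_sym val_eqE (negPf ti) mul0r.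
  by rewrite mxrankMfree ?rank_pid_mx // /row_free rkA.
pose S := [set j | (c j < m)%N]%SET.
have free0 : \rank (row_filter B finset.set0) = #|finset.set0 : {set 'I_n}|.
  by apply/eqP; rewrite cards0 -leqn0 -(cards0 'I_n) rank_row_filter.
have [J1 [_ J1S freeJ1 SJ1]] := free_rows_extend (finset.sub0set S) free0.
have [J [J1J _ freeJ TJ]] := free_rows_extend (finset.subsetT J1) freeJ1.
have BT : row_filter B finset.setT = B.
  by apply/matrixP => i j; rewrite !mxE finset.in_setT.
have cJ : #|J| = q.
  rewrite -freeJ -rkB; apply/eqP; rewrite eqn_leq !mxrankS //.
    by rewrite -{1}BT.
  by apply/row_filter_subP => i _; apply: row_sub.
have Jk : (0 < #|J| <= k)%N by rewrite cJ q0.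
exists (exist _ J Jk) => //; split; last first.
  rewrite -mxrank_tr trmx_mul tr_diag_mx.
  have -> : diag_mx (\row_j (c j < m)%N%:R) *m B = row_filter B S.
    apply/matrixP => i j; rewrite mul_diag_mx !mxE inE.
    by case: (c i < m)%N; rewrite ?mul1r ?mul0r.
  apply: leq_trans (mxrankS SJ1) _; rewrite freeJ1 -sum1_card /=.
  rewrite [leqRHS](finset.big_setID J1) /= (finset.setIidPr J1J) -[leqLHS]addn0 leq_add //.
  by apply: leq_sum => j /(fintype.subsetP J1S); rewrite inE => ->.
rewrite /flag_minor; set h := widen_ord _; set g := enum_val.
rewrite -unitfE -unitmxE -row_free_unit /row_free -mxrank_tr eqn_leq rank_leq_row /=.
rewrite -[X in (X <= _)%N]freeJ.
apply: (@leq_trans (\rank (rowsub g B))).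
  apply/mxrankS/row_filter_subP => i iJ.
  by rewrite -[i in row i](enum_rankK_in iJ iJ) -row_rowsub row_sub.
(* The selected rows of [B] are the transposed minor padded by zero columns, so the minor inherits
   rank [#|J|]. *)
have -> : rowsub g B = (mxsub h g A)^T *m (pid_mx #|J| : 'M_(#|J|, k)).
  apply/matrixP => a i; rewrite !mxE; have [iq|qi] := ltnP i q; last first.
    rewrite big1 // => t _; rewrite !mxE [_ == _ :> nat](_ : _ = false) ?mulr0 //.
    by apply/negbTE; rewrite neq_ltn (leq_trans (ltn_ord t)) //= cJ.
  rewrite -cJ in iq; rewrite (bigD1 (Ordinal iq)) //= big1 => [|t].
    rewrite !mxE /= eqxx iq mulr1 addr0; congr (A _ _).
    exact: val_inj.
  by rewrite !mxE -val_eqE /= => /negPf ->; rewrite mulr0.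
exact: mxrankM_maxl.
Qed.

Lemma rank_variety_flag_minors f A : \rank A = k ->
  (forall J m, (rank_bound f #|val J| m < \sum_(j in val J) (c j < m))%N ->
     flag_minor J A = 0) ->
  rank_variety f A.
Proof.
move=> rkA minA q m.
have [-> |q0] := posnP q.
  rewrite (_ : top_rows 0 A = 0) ?mul0mx ?mxrank0 //.
  by apply/matrixP => i j; rewrite !mxE.
(* Beyond [k], neither the truncated matrix nor the bound changes with [q]. *)
wlog qk : q q0 / (q <= k)%N.
  move=> H; have [/H|kq] := leqP q k; first exact.
  have [k0|k0] := posnP k.
    have := rank_leq_row (top_rows q A *m col_filter m).
    by rewrite [X in (_ <= X)%N]k0 leqn0 => /eqP ->.
  have := H k k0 (leqnn k).
  have -> : top_rows q A = top_rows k A.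
    by apply/matrixP => i j; rewrite !mxE ltn_ord (ltn_trans (ltn_ord i) kq).
  rewrite (_ : rank_bound f q m = rank_bound f k m) //.
  by apply: eq_card => i; rewrite !inE ltn_ord (ltn_trans (ltn_ord i) kq).
have q0k : (0 < q <= k)%N by rewrite q0.
have [J cJ [/eqP nzJ leJ]] := flag_minor_basis m q0k rkA.
by apply: leq_trans leJ _; rewrite leqNgt; apply/negP; rewrite -cJ => /minA.
Qed.

End FlagMinors.

(** * Flag minors as multihomogeneous polynomials *)

Section MinorPolynomials.
Variables (F : fieldType) (k n : nat).
Implicit Types (J : flag_index k n) (A : 'M[F]_(k, n)).

Definition minor_poly J : {mpoly F[k * n]} :=
  \det (\matrix_(a, b) 'X_(mxvec_index (widen_ord (flag_index_le J) a)
                                       (@enum_val _ (mem (val J)) b))).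

Lemma eval_minor_poly J A : eval_mx (minor_poly J) A = flag_minor J A.
Proof.
rewrite /eval_mx /minor_poly /flag_minor -det_map_mx; congr (\det _).
by apply/matrixP => a b; rewrite !mxE /= mevalXU mxvecE.
Qed.

Lemma mxvec_index_eq (i i' : 'I_k) (j j' : 'I_n) :
  (mxvec_index i j == mxvec_index i' j') = (i == i') && (j == j').
Proof.
apply/eqP/idP => [|/andP[/eqP -> /eqP -> //]].
have [g gK _] := curry_mxvec_bij k n.
by move=> e; have := gK (i, j) isT; rewrite /= e (gK (i', j')) // => -[-> ->]; rewrite !eqxx.
Qed.

(** Each Leibniz term takes exactly one entry from every column of [J] and none from the others. *)
Lemma minor_poly_multihomog J : multihomog (fun j => j \in val J) (minor_poly J).
Proof.
move=> m; rewrite /minor_poly; set h := widen_ord _; set g := enum_val.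
rewrite /determinant => /msupp_sum_le /flattenP[ms /mapP[s _ ->]].
under eq_bigr => a _ do rewrite mxE.
rewrite mprodXE mulr_sign => ms_m.
have {ms_m} -> : m = (\sum_a U_(mxvec_index (h a) (g (s a))))%MM.
  by move: ms_m; case: (odd_perm s); rewrite ?(perm_mem (msuppN _)) msuppX inE => /eqP.
move=> j; transitivity (\sum_(i < k) \sum_(a < #|val J|)
    U_(mxvec_index (h a) (g (s a)))%MM (mxvec_index i j))%N.
  by apply: eq_bigr => i _; exact: mnm_sumE.
rewrite exchange_big /=.
transitivity (\sum_(a < #|val J|) (g (s a) == j))%N.
  apply: eq_bigr => a _; rewrite (bigD1 (h a)) //= big1 => [|i ia].
    by rewrite mnm1E mxvec_index_eq eqxx addn0.
  by rewrite mnm1E mxvec_index_eq eq_sym (negPf ia).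
transitivity (\sum_(a < #|val J|) (g a == j))%N.
  by rewrite [RHS](reindex_inj (@perm_inj _ s)).
rewrite -(big_enum_val (fun x => nat_of_bool (x == j))).
have [jJ|jJ] := boolP (j \in val J).
  by rewrite (bigD1 j) //= eqxx big1 // => i /andP[_ /negPf ->].
by rewrite big1 // => i iJ; case: eqP iJ jJ => // -> ->.
Qed.

End MinorPolynomials.

(** * Fubini words, patterns and elimination *)

Section PRCells.
Variables (F : fieldType) (k n : nat) (w : n.-tuple 'I_k).
Hypothesis fub : fubini w.
Implicit Types (Q Y B : 'M[F]_(k, n)) (X : 'M[F]_k).

Local Notation f := (alpha w).
Definition letter_alpha (j : 'I_n) := alpha w (tnth w j).
Local Notation c := letter_alpha.

Lemma alpha_inj : injective f.
Proof.
by move=> i j /eqP; rewrite /alpha => /eqP; apply: (@index_inj _ i); rewrite ?(forallP fub).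
Qed.

Lemma alpha_lt i : (f i < n)%N.
Proof. by rewrite /alpha -{2}(size_tuple w) index_mem (forallP fub). Qed.

Lemma tnth_alpha (i : 'I_k) (j : 'I_n) : f i = j -> tnth w j = i.
Proof. by move=> e; rewrite (tnth_nth i) -e nth_index // (forallP fub). Qed.

Lemma initial_alpha j : initial w j = (f (tnth w j) == j :> nat).
Proof.
apply/existsP/idP => [[i /eqP e]|e]; last by exists (tnth w j).
by rewrite (tnth_alpha e) e.
Qed.

(** The position quantified in [star] is initial and carries the letter [r], so it is the first
    occurrence of [r]. *)
Lemma starP r j : star w r j =
  [&& r != tnth w j, (f r < c j)%N & initial w j ==> (r < tnth w j)%N].
Proof.
rewrite /star; congr (_ && _); apply/existsP/andP => [ex_i | [rj ij]].
  case: ex_i => i; case/and4P=> /eqP wi; rewrite initial_alpha wi => /eqP -> ltj.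
  by rewrite ltj; case: initial; rewrite ?orbF //= => ->.
have wi : tnth w (Ordinal (alpha_lt r)) = r by apply: tnth_alpha.
exists (Ordinal (alpha_lt r)); rewrite initial_alpha wi eqxx /= rj eqxx /=.
by case: initial ij; rewrite ?orbF.
Qed.

(** With letters in order of appearance, the columns at first occurrences form a triangular matrix
    with nonzero diagonal. *)
Lemma staircase_row_free Q : staircase c f Q -> row_free Q.
Proof.
case=> Qf Qp; apply: inj_row_free => v vQ; apply/rowP => r; rewrite mxE.
have [d] := ubnP (f r); elim: d => // d IHd in r *; rewrite ltnS => led.
pose j := Ordinal (alpha_lt r).
have wj : tnth w j = r by apply: tnth_alpha.
have cj : f r = c j by rewrite /c wj.
have /matrixP/(_ 0 j) := vQ; rewrite !mxE (bigD1 r) //= big1 => [|s sr].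
  by move/eqP; rewrite addr0 mulf_eq0 (negPf (Qp _ _ cj)) orbF => /eqP.
have [->|/Qf] := eqVneq (Q s j) 0; first by rewrite mulr0.
rewrite -cj leq_eqVlt => /orP[/eqP/alpha_inj e|lts]; first by rewrite e eqxx in sr.
by rewrite IHd ?mul0r // (leq_trans lts).
Qed.

Lemma lower_unitri_mul X X' :
  lower_unitri X -> lower_unitri X' -> lower_unitri (X *m X').
Proof.
case=> X1 X0 [X'1 X'0]; split=> [i|i j ij]; rewrite !mxE.
  rewrite (bigD1 i) //= X1 X'1 mulr1 big1 ?addr0 // => t.
  by rewrite neq_ltn => /orP[/X'0 ->|/X0 ->]; rewrite ?mulr0 ?mul0r.
rewrite big1 // => t _; have [it|ti] := ltnP i t; first by rewrite X0 // mul0r.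
by rewrite X'0 ?mulr0 // (leq_ltn_trans ti).
Qed.

(* Gaussian elimination below the pivots of the initial columns, from left to
   right: subtracting a multiple of the row of a letter from the rows of the
   letters that appear earlier preserves the staircase shape. *)
Lemma staircase_eliminate Q m : staircase c f Q ->
  exists X Q', [/\ lower_unitri X, Q = X *m Q', staircase c f Q' &
    forall (j : 'I_n) (r : 'I_k), (j < m)%N -> initial w j -> (tnth w j < r)%N -> Q' r j = 0].
Proof.
move=> Qst; elim: m => [|m [X [Q' [Xu QE [Qf Qp] Q0]]]].
  exists 1%:M, Q; split=> //; last by rewrite mul1mx.
  split=> [i|i j ij]; rewrite mxE ?eqxx // -val_eqE /= (ltn_eqF ij).
  by rewrite mulr0n.
have [mn|nm] := ltnP m n; last first.
  exists X, Q'; split=> // j r jm; apply: Q0.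
  exact: leq_trans (ltn_ord j) nm.
pose j0 := Ordinal mn; pose s := tnth w j0.
have [init|ninit] := boolP (initial w j0); last first.
  exists X, Q'; split=> // j r; rewrite ltnS leq_eqVlt => /orP[/eqP jm|]; last exact: Q0.
  by rewrite (_ : j = j0) ?(negPf ninit) //; apply: val_inj.
have fs : f s = m by apply/eqP; rewrite -(initial_alpha j0).
have Qs : Q' s j0 != 0 by apply: Qp.
pose a (r : 'I_k) := if (s < r)%N then Q' r j0 / Q' s j0 else 0.
have a0 r : a r != 0 -> (s < r)%N /\ (f r <= f s)%N.
  rewrite /a; case: ifP => [sr|_]; last by rewrite eqxx.
  by rewrite mulf_eq0 negb_or => /andP[/Qf].
have as0 : a s = 0 by rewrite /a ltnn.
pose Q2 : 'M[F]_(k, n) := \matrix_(r, j) (Q' r j - a r * Q' s j).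
pose E : 'M[F]_k := \matrix_(r, t) ((r == t)%:R + a r *+ (t == s)).
exists (X *m E), Q2; split.
- apply: lower_unitri_mul Xu _; split=> [i|i j ij]; rewrite mxE ?eqxx.
    by have [->|_] := eqVneq i s; rewrite ?as0 ?mulr0n ?mul0rn addr0.
  rewrite -val_eqE /= (ltn_eqF ij) add0r; have [js|_] := eqVneq j s => //.
  rewrite mulr1n /a -js; case: ifP => // ji.
  by move: (ltn_trans ij ji); rewrite ltnn.
- rewrite QE -mulmxA; congr (_ *m _); apply/matrixP => r j; rewrite !mxE.
  under eq_bigr => t _ do rewrite mxE mulrDl.
  rewrite big_split /= (bigD1 r) //= eqxx mul1r big1 => [|t /negPf tr]; last first.
    by rewrite eq_sym tr mul0r.
  rewrite (bigD1 s) //= eqxx big1 => [|t /negPf ->]; last by rewrite mulr0n mul0r.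
  by rewrite !mxE as0 mul0r subr0 mulr1n !addr0 subrK.
- split=> r j; rewrite mxE.
    have [q0|q0 _] := eqVneq (Q' r j) 0; last exact: Qf.
    rewrite q0 sub0r oppr_eq0 mulf_eq0 negb_or => /andP[/a0[_ rs] /Qf].
    exact: leq_trans.
  move=> fc; have [->|ar] := eqVneq (a r) 0.
    by rewrite mul0r subr0; apply: Qp.
  suff -> : Q' s j = 0 by rewrite mulr0 subr0; apply: Qp.
  apply: contraTeq ar => /Qf; rewrite -fc => sr; apply/negP => /a0[sr' rs].
  have /alpha_inj e : f s = f r by apply/eqP; rewrite eqn_leq sr rs.
  by rewrite e ltnn in sr'.
- move=> j r; rewrite ltnS leq_eqVlt => /orP[/eqP jm|jm] jin jr; rewrite mxE; last first.
    (* Earlier initial columns keep their zeros: such a column is labelled by its own position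
       [j < m = f s], where row [s] still vanishes. *)
    rewrite Q0 // sub0r (_ : Q' s j = 0) ?mulr0 ?oppr0 //.
    apply: contraTeq jm => /Qf; rewrite fs -leqNgt => /leq_trans; apply.
    by move: jin; rewrite initial_alpha /c => /eqP ->.
  have jj : j = j0 by apply: val_inj.
  by rewrite jj /a /s -jj jr jj divfK ?subrr.
Qed.

End PRCells.

(** * PR cells as staircase cells modulo the torus, and the two inclusions *)

Section PRFrames.
Variables (F : fieldType) (k n : nat) (w : n.-tuple 'I_k).
Hypothesis fub : fubini w.
Implicit Types (Q Y B : 'M[F]_(k, n)) (X : 'M[F]_k).
Local Notation f := (alpha w).
Local Notation c := (letter_alpha w).
Local Notation pi := (\pi_(line_config F k n))%qT.

Lemma pattern_le Y r j : pattern w Y -> Y r j != 0 -> (f r <= c j)%N.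
Proof.
move=> wY; have [|nstar] := boolP (star w r j).
  by rewrite starP // => /and3P[_ /ltnW].
rewrite wY // mxE; case: (r =P tnth w j) => [-> //|_].
by rewrite eqxx.
Qed.

Lemma staircase_cell_frame B : staircase_cell c f B ->
  (\rank B == k) && [forall j, col j B != 0].
Proof.
case=> X [Q [_ Xu Qst ->]]; apply/andP; split.
  have fullX : row_full X by rewrite row_full_unit.
  by rewrite (eqmxMfull Q fullX); apply: (staircase_row_free fub Qst).
apply/forallP => j; rewrite colE -mulmxA -colE; apply/negP => /eqP Xj.
have /colP/(_ (tnth w j)) : col j Q = 0 by rewrite -(mulKmx Xu (col j Q)) Xj mulmx0.
by rewrite !mxE => /eqP; apply/negP; apply: Qst.2.
Qed.

(** Move the diagonal of [X] into [Q], eliminate below the initial pivots, then divide column [j] by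
    its entry in row [w_j], which is nonzero because that row and the column share a label. *)
Lemma staircase_cell_factor B : staircase_cell c f B ->
  exists X Y (z : 'I_n -> F), [/\ lower_unitri X, pattern w Y,
    forall j, z j != 0 & forall i j, B i j = (X *m Y) i j * z j].
Proof.
case=> X [Q [/is_trig_mxP Xt Xu [Qf Qp] ->]].
have Xd i : X i i != 0.
  move: Xu; rewrite unitmxE det_trig; last exact/is_trig_mxP.
  by rewrite unitfE => /prodf_neq0 /(_ i isT).
pose d : 'rV[F]_k := \row_i X i i.
pose X1 : 'M[F]_k := \matrix_(i, t) (X i t / X t t).
have XE : X = X1 *m diag_mx d.
  by apply/matrixP => i t; rewrite mul_mx_diag !mxE divfK.
have dQ : staircase c f (diag_mx d *m Q).
  split=> r j; rewrite mul_diag_mx !mxE mulf_eq0 (negPf (Xd r)); first exact: Qf.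
  exact: Qp.
have [X2 [Q2 [X2u QE [Q2f Q2p] Q20]]] := staircase_eliminate fub n dQ.
have wp j : Q2 (tnth w j) j != 0 by apply: Q2p.
exists (X1 *m X2), (\matrix_(i, j) (Q2 i j / Q2 (tnth w j) j)), (fun j => Q2 (tnth w j) j).
split=> //.
- apply: lower_unitri_mul X2u; split=> [i|i j ij]; rewrite mxE ?divff //.
  by rewrite Xt // mul0r.
- move=> r j; rewrite starP // !mxE; have [->|rj] := eqVneq r (tnth w j).
    by rewrite divff.
  rewrite /= negb_and => nstar; suff -> : Q2 r j = 0 by rewrite mul0r.
  (* A letter not appearing before [w_j] gives zero by the staircase shape and injectivity of
     [alpha]; a larger letter in an initial column gives zero by elimination. *)
  case/orP: nstar => [|]; last rewrite negb_imply; rewrite -leqNgt.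
    move=> cf; apply: contraNeq rj => /Q2f fc; apply/eqP/(alpha_inj fub)/eqP.
    by rewrite eqn_leq fc cf.
  case/andP=> jin; rewrite leq_eqVlt => /orP[/eqP/val_inj e|]; first by rewrite e eqxx in rj.
  exact: Q20.
- move=> i j; rewrite XE -mulmxA QE mulmxA !mxE mulr_suml; apply: eq_bigr => t _.
  by rewrite !mxE -mulrA divfK.
Qed.

Lemma staircase_cell_PR_cell B : staircase_cell c f B ->
  exists2 A : frame F k n, val A = B & PR_cell F w (pi A).
Proof.
move=> Bcell; have Bfr := staircase_cell_frame Bcell.
have [X [Y [z [Xu wY z0 BE]]]] := staircase_cell_factor Bcell.
have BXY : B = X *m Y *m diag_mx (\row_j z j).
  by apply/matrixP => i j; rewrite mul_mx_diag [RHS]mxE BE; congr (_ * _); rewrite mxE.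
have XYfr : (\rank (X *m Y) == k) && [forall j, col j (X *m Y) != 0].
  have /andP[/eqP rkB /forallP colB] := Bfr.
  apply/andP; split.
    by rewrite eqn_leq rank_leq_row -[X in (X <= _)%N]rkB BXY mxrankM_maxl.
  apply/forallP => j; apply: contra (colB j) => /eqP/colP XYj.
  apply/eqP/colP => i; have XY0 : (X *m Y) i j = 0.
    by have := XYj i; rewrite mxE [RHS]mxE.
  by rewrite mxE [RHS]mxE BE XY0 mul0r.
exists (exist _ B Bfr) => //; exists (exist _ (X *m Y) XYfr).
  by apply/eqmodP; rewrite equiv_sym; apply/torus_eqP; exists z.
by exists X, Y.
Qed.

(** A minor nonzero at a point of the cell would make a filtered rank exceed the bound that holds on
    staircase products. *)
Lemma PR_flags_rank_bound (J : flag_index k n) m :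
  (rank_bound f #|val J| m < \sum_(j in val J) (c j < m))%N -> PR_flags F w J.
Proof.
move=> ltJ x [A -> [X [Y [[X1 X0] wY AE]]]]; apply/minor_vanish.
apply: contraTeq ltJ => nz; rewrite -leqNgt.
apply: leq_trans (flag_minor_rank c m nz) _; rewrite AE.
apply: staircase_rank_variety; first exact/is_trig_mxP.
by move=> r j; apply: pattern_le.
Qed.

(** The zero locus of one flag minor is closed, being cut out by [minor_poly J], so it contains the
    closure as soon as it contains the cell. *)
Lemma PR_variety_sub_minors x : PR_variety F w x ->
  forall J : flag_index k n, PR_flags F w J -> minor_vanish_at J x.
Proof.
move=> wx J wJ.
have /wx : zariski_closed [set y : line_config F k n | minor_vanish_at J y]%classic /\
    (PR_cell F w `<=` [set y | minor_vanish_at J y])%classic; last exact.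
split; last by move=> y /wJ.
exists [set minor_poly F J]%classic.
  by move=> p ->; exists (fun j => j \in val J); apply: minor_poly_multihomog.
apply/seteqP; split=> y /= yJ; first by move=> p ->; rewrite /vanish_at eval_minor_poly.
by have := yJ _ erefl; rewrite /vanish_at eval_minor_poly.
Qed.

End PRFrames.

(** An equation of a closed set containing the cell vanishes on all staircase products, hence on
    their affine closure, where the rank conditions place the representative of [x]. *)
Lemma minors_sub_PR_variety (F : numFieldType) (k n : nat) (w : n.-tuple 'I_k)
    (x : line_config F k n) : fubini w ->
  (forall J : flag_index k n, PR_flags F w J -> minor_vanish_at J x) -> PR_variety F w x.
Proof.
move=> fub wx C [[S Shom ->] Ccell] p Sp.
have /andP[/eqP rkx _] := valP (repr x).
have : mx_closure (staircase_cell (letter_alpha w) (alpha w)) (val (repr x)).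
  apply: rank_variety_closure; apply: rank_variety_flag_minors => // J m ltJ.
  exact: wx (PR_flags_rank_bound fub ltJ).
apply=> B /(staircase_cell_PR_cell fub)[A <- /Ccell/(_ p Sp)].
by have [d pd] := Shom p Sp; move/(multihomog_vanish _ pd).
Qed.

Local Open Scope classical_set_scope.

Theorem theorem1p5 (R : realType) (n k : nat) (w : n.-tuple 'I_k) :
  (1 <= k)%N -> (k <= n)%N -> fubini w ->
  PR_variety R[i] w =
  [set A : line_config R[i] k n |
     forall J : flag_index k n, PR_flags R[i] w J -> minor_vanish_at J A].
Proof.
move=> _ _ fub; apply/seteqP; split=> x; first exact: PR_variety_sub_minors.
exact: minors_sub_PR_variety.
Qed.
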